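(* Let $C=e^{-6}$ and $\psi(x)=Cx$. Let $d\ge1$ and let $f_{\psi,d}:\{1,\dots,d\}\to\mathbb{R}_{>0}$ be defined by $f_{\psi,d}(d)=1$ and $f_{\psi,d}(i)=\sqrt{\psi(d-i+1)}\left(\prod_{k=i}^d f_{\psi,d}(k)\right)^{\frac1{d-i+1}}$ for $i<d$. Then for all $1\le i<j\le d$, \[ (j-i+1)^{-\frac{j-i}{2}}\left(1-\left(\frac{f_{\psi,d}(j)}{f_{\psi,d}(i)}\right)^2\right)_+^{\frac{j-i}{2}}\left(\prod_{k=i}^j\frac{f_{\psi,d}(i)}{f_{\psi,d}(k)}\right)\le\exp\left(-\frac52(j-i)\right). \]
   Context: $(x)_+=\max(x,0)$. The defining relation determines $f_{\psi,d}(i)$ uniquely via $f_{\psi,d}(i)^{d-i}=\psi(d-i+1)^{\frac{d-i+1}{2}}\prod_{k=i+1}^d f_{\psi,d}(k)$, computed recursively downward from $i=d-1$. *)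

(* Defs.v *)
From mathcomp Require Import all_boot all_order all_algebra.
From mathcomp Require Import all_classical all_reals all_analysis.
Set Implicit Arguments.
Unset Strict Implicit.
Unset Printing Implicit Defensive.
Import Order.TTheory GRing.Theory Num.Theory.
Local Open Scope ring_scope.

Definition pospart (R : realType) (x : R) : R := Num.max x 0.

(* [f] stands for f_{psi,d}, a function on {1, ..., d}; its values outside this
   range are irrelevant. The last equation is implicit, since the product
   includes [f i] itself; together with positivity it determines [f i] from
   f (i+1), ..., f d. *)
Definition is_fpsi (R : realType) (psi : R -> R) (d : nat) (f : nat -> R)
    : Prop :=
  [/\ forall i : nat, (1 <= i <= d)%N -> 0 < f i,
      f d = 1
    & forall i : nat, (1 <= i < d)%N ->
        f i = Num.sqrt (psi (d - i + 1)%:R)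
              * (\prod_(i <= k < d.+1) f k) `^ (d - i + 1)%:R^-1].

(* Main.v *)
Require Import Defs.
From mathcomp Require Import all_boot all_order all_algebra.
From mathcomp Require Import all_classical all_reals all_analysis.
From mathcomp Require Import ring lra.
Import Order.TTheory GRing.Theory Num.Theory.
Local Open Scope ring_scope.

(** Taking logarithms, the defining relation says that for [i < d] the sum of
    [ln (f k)] over [i <= k <= d] is
    [(d - i + 1) (ln (f i) - ln (psi (d - i + 1)) / 2)], so the sum over
    [i <= k <= j] is explicit and no recursion has to be solved.  With
    [N = d - j], [n = j - i] and [x = (f j / f i) ^ 2] there remains the
    inequality [xlnx_gap_le], which holds for every [x] in (0, 1): it follows
    from [ln y <= y - 1] used at three points. *)

Lemma ln_mul_div_le {R : realType} (x a b : R) :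
  0 < x -> 0 < a -> 0 < b -> ln x + ln a - ln b <= x * a / b - 1.
Proof.
move=> x0 a0 b0; rewrite -lnM ?posrE // -ln_div ?posrE ?mulr_gt0 //.
set y := x * a / b; have y0 : 0 < y by rewrite divr_gt0 ?mulr_gt0.
by rewrite -{1}[y](subrKC 1) le_ln1Dx // ltrBrDl addrN.
Qed.

Lemma xlnx_gap_le {R : realType} (n N x : R) :
  0 <= n -> 0 <= N -> 0 < x < 1 ->
  (n + N + 1) * ln (n + N + 1) - (N + 1) * ln (N + 1) - n * ln (n + 1)
    + n * ln (1 - x) + N * ln x <= n.
Proof.
move=> n0 N0 /andP[x0 x1].
have n1 : 0 < n + 1 by lra.
have N1 : 0 < N + 1 by lra.
have M1 : 0 < n + N + 1 by lra.
have y0 : 0 < 1 - x by lra.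
(* With M = n + N + 1, the three points are (1 - x) M / (n + 1), x M / (N + 1) and M / (N + 1).
   Their weights n, N and 1 add up to M, which produces the term M ln M. *)
have Hn := ler_wpM2l n0 (ln_mul_div_le _ _ _ y0 M1 n1).
have HN := ler_wpM2l N0 (ln_mul_div_le _ _ _ x0 M1 N1).
have H1 := ln_mul_div_le _ _ _ ltr01 M1 N1.
rewrite ln1 add0r mul1r in H1.
suff : n * ((1 - x) * (n + N + 1) / (n + 1) - 1)
     + N * (x * (n + N + 1) / (N + 1) - 1) + ((n + N + 1) / (N + 1) - 1) <= n.
  by lra.
rewrite -subr_ge0.
(* the expression is affine in [x], so it is enough to look at [x = 0, 1] *)
rewrite (_ : _ - _ = (1 - x) * (N / (n + 1) + n * N / (N + 1))
                     + x * n); last by field; rewrite !lt0r_neq0.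
have q0 : 0 <= N / (n + 1) + n * N / (N + 1).
  by rewrite addr_ge0 ?divr_ge0 ?mulr_ge0 // ltW.
by rewrite addr_ge0 ?mulr_ge0 // ltW.
Qed.

Lemma sum_ln_fpsi {R : realType} {psi : R -> R} {d : nat} {f : nat -> R}
    (i : nat) :
  is_fpsi psi d f -> (1 <= i < d)%N -> 0 < psi (d - i + 1)%:R ->
  \sum_(i <= k < d.+1) ln (f k)
    = (d - i + 1)%:R * (ln (f i) - ln (psi (d - i + 1)%:R) / 2).
Proof.
move=> [fpos _ fE] hi psi0; have /andP[i1 id] := hi.
have fk k : (i <= k < d.+1)%N -> 0 < f k.
  by move=> /andP[ik kd]; rewrite fpos // (leq_trans i1).
have prod_gt0 : 0 < \prod_(i <= k < d.+1) f k.
  by rewrite big_nat prodr_gt0.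
have prodE : \prod_(i <= k < d.+1) f k = expR (\sum_(i <= k < d.+1) ln (f k)).
  rewrite expR_sum !big_nat; apply: eq_bigr => k kb.
  by rewrite lnK // posrE fk.
have m0 : ((d - i + 1)%:R : R) != 0 by rewrite pnatr_eq0 addn1.
have sqrtE : ln (Num.sqrt (psi (d - i + 1)%:R)) = ln (psi (d - i + 1)%:R) / 2.
  rewrite -[in RHS](sqr_sqrtr (ltW psi0)) lnXn ?sqrtr_gt0 //; lra.
(* Once [f i] is unfolded, its square root cancels the [psi] term and the exponent 1 / (d - i + 1)
   cancels the prefactor. *)
rewrite [in RHS](fE _ hi) lnM ?posrE ?sqrtr_gt0 ?powR_gt0 // sqrtE ln_powR.
by rewrite [_ + _ - _]addrC addKr mulrA divff // mul1r prodE expRK.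
Qed.

Theorem theorem7 (R : realType) (C : R) (psi : R -> R) (d : nat) (f : nat -> R)
    (hC : C = expR (- 6))
    (hpsi : forall x : R, psi x = C * x)
    (hd : (1 <= d)%N)
    (hf : is_fpsi psi d f)
    (i j : nat) (hi : (1 <= i)%N) (hij : (i < j)%N) (hj : (j <= d)%N) :
  (j - i + 1)%:R `^ (- ((j - i)%:R / 2))
  * pospart (1 - (f j / f i) ^+ 2) `^ ((j - i)%:R / 2)
  * (\prod_(i <= k < j.+1) (f i / f k))
  <= expR (- (5 / 2) * (j - i)%:R).
Proof.
have [fpos fd _] := hf.
have fi0 : 0 < f i by rewrite fpos // hi (leq_trans (ltnW hij)).
have fj0 : 0 < f j by rewrite fpos // (leq_trans hi (ltnW hij)).
have n0 : 0 < (j - i)%:R :> R by rewrite ltr0n subn_gt0.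
set x := (f j / f i) ^+ 2.
have x0 : 0 < x by rewrite exprn_gt0 // divr_gt0.
have [x1|x1] := leP 1 x.
  (* The positive part is 0, and its exponent is nonzero because i < j; 0 to the power 0 would be
     1. *)
  rewrite /pospart max_r ?subr_le0 // powR0 ?mulr0 ?mul0r ?expR_ge0 //.
  by rewrite mulf_neq0 ?invr_eq0 // lt0r_neq0.
rewrite /pospart max_l ?subr_ge0 ?(ltW x1) //.
have psiE m : psi (m + 1)%:R = expR (- 6) * (m + 1)%:R by rewrite hpsi hC.
have psi_gt0 m : 0 < psi (m + 1)%:R.
  by rewrite psiE mulr_gt0 ?expR_gt0 // ltr0n addn1.
have lnpsi m : ln (psi (m + 1)%:R) = - 6 + ln (m + 1)%:R.
  by rewrite psiE lnM ?posrE ?expR_gt0 ?ltr0n ?addn1 // expRK.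
have sum_i := sum_ln_fpsi i hf _ (psi_gt0 _).
rewrite hi (leq_trans hij hj) lnpsi in sum_i; have {}sum_i := sum_i isT.
(* at [j = d] the relation fails, but only in the favourable direction *)
have sum_j : \sum_(j <= k < d.+1) ln (f k)
    <= (d - j + 1)%:R * (ln (f j) - (- 6 + ln (d - j + 1)%:R) / 2).
  have [jd|dj] := ltnP j d.
    by rewrite (sum_ln_fpsi j hf) ?lnpsi // (leq_trans hi (ltnW hij)).
  have -> : j = d by apply/eqP; rewrite eqn_leq hj.
  by rewrite big_nat1 subnn fd ln1; lra.
have prodE : \prod_(i <= k < j.+1) (f i / f k)
    = expR ((j - i + 1)%:R * ln (f i) - \sum_(i <= k < j.+1) ln (f k)).
  have -> : (j - i + 1)%:R * ln (f i) = \sum_(i <= k < j.+1) ln (f i).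
    by rewrite sumr_const_nat mulr_natl addn1 subSn ?(ltnW hij).
  rewrite -sumrB expR_sum !big_nat; apply: eq_bigr => k /andP[ik kj].
  have fk0 : 0 < f k.
    by rewrite fpos // (leq_trans hi ik) (leq_trans (_ : k <= j)%N).
  by rewrite -ln_div ?posrE // lnK ?posrE ?divr_gt0.
(* The index [j] lies in both ranges, hence the correction by ln (f j). *)
have split_sum : \sum_(i <= k < d.+1) ln (f k)
    = \sum_(i <= k < j.+1) ln (f k) + \sum_(j <= k < d.+1) ln (f k) - ln (f j).
  rewrite (@big_cat_nat _ _ _ j.+1) //=; last by rewrite (leq_trans (ltnW hij)).
  by rewrite [in RHS](@big_ltn _ _ _ j) //; lra.
have lnx : ln x = 2 * (ln (f j) - ln (f i)).
  by rewrite lnXn ?divr_gt0 // ln_div ?posrE // mulr_natl.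
have y0 : 0 < 1 - x by rewrite subr_gt0.
have dE : (d - i)%N = (j - i + (d - j))%N.
  by rewrite addnC addnBA ?subnK // ltnW.
have := xlnx_gap_le (j - i)%:R (d - j)%:R x (ltW n0) (ler0n _ _).
rewrite x0 x1 lnx => /(_ isT).
rewrite /powR !gt_eqF // ?ltr0n ?addn_gt0 ?orbT // prodE -!expRD ler_expR.
(* The terms in ln (f i) and ln (f j) collect to N ln x / 2, and ln C = -6 contributes -3 n. So the
   exponent on the left is at most half the left side of [xlnx_gap_le] minus 3 n, that is, at most n
   / 2 - 3 n. *)
move: sum_i sum_j; rewrite split_sum dE !natrD.
lra.
Qed.
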